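(* Let $M$ be any totally umbilical submanifold of a Sasakian manifold $\overline M$ such that $\xi\in\Gamma(TM)$. Then $M$ is totally geodesic.
   Context: A Sasakian manifold $(\overline M^{2m+1},\phi,\xi,\eta,g)$ consists of a Riemannian metric $g$ with Levi-Civita connection $\widetilde\nabla$, a $(1,1)$-tensor field $\phi$, a vector field $\xi$ (the Reeb field) and a 1-form $\eta$ with $\phi^2X=-X+\eta(X)\xi$, $\eta(\xi)=1$, $\phi\xi=0$, $g(\phi X,\phi Y)=g(X,Y)-\eta(X)\eta(Y)$ and $(\widetilde\nabla_X\phi)Y=g(X,Y)\xi-\eta(Y)X$; in particular $\widetilde\nabla_X\xi=-\phi X$. A submanifold with second fundamental form $h$ is totally umbilical if $h(U,V)=g(U,V)H$ for all tangent $U,V$, where $H$ is the mean curvature vector, and totally geodesic if $h=0$. *)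

(* Defs.v *)
From HB Require Import structures.
From mathcomp Require Import all_boot all_order all_algebra.
From mathcomp Require Import all_classical all_reals all_analysis.
From mathcomp Require Import ring.

Set Implicit Arguments.
Unset Strict Implicit.
Unset Printing Implicit Defensive.

Import Order.TTheory GRing.Theory Num.Theory.
Import numFieldNormedType.Exports.

Local Open Scope classical_set_scope.
Local Open Scope ring_scope.

Section Ck.
Context {R : realType}.
Implicit Types (V W : normedModType R) (k : nat).

(* C^k on a set U, meant for U open: C^0 is continuity, and f is C^(k+1) when it
   is Frechet differentiable at every point of U and all its directional
   derivatives x |-> df_x(v) are C^k on U. *)
Fixpoint Ck {V W} k (U : set V) (f : V -> W) : Prop :=
  if k is k'.+1 then
    (forall x, U x -> differentiable f x) /\ (forall v, Ck k' U ('D_v f))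
  else forall x, U x -> {for x, continuous f}.

Lemma eq_differentiable V W (f g : V -> W) x :
  (\near x, f x = g x) -> differentiable f x -> differentiable g x.
Proof.
move=> fg df; have fgx := nbhs_singleton fg.
suff d0 : differentiable (g - f) x.
  by rewrite -(subrK f g); exact: differentiableD.
have fg0 : \forall h \near (0 : V), f (h + x) = g (h + x).
  rewrite (near_shift x) /=; near=> y.
  by rewrite /= sub0r subrK; near: y.
have e0 : (g - f) \o shift x =
    cst ((g - f) x) + (\0%R : {linear V -> W}) +o_ (0 : V) id.
  apply/eqaddoP => e e_gt0; near=> h => /=.
  rewrite !fctE /= fgx subrr !addr0 subr0.
  have -> : f (h + x) = g (h + x) by near: h.
  by rewrite subrr normr0 mulr_ge0 ?normr_ge0 ?ltW.
have c0 : continuous (\0%R : {linear V -> W}) by exact: cst_continuous.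
have de : 'd (g - f) x = \0%R :> (V -> W) by exact: (diff_unique c0 e0).
apply/diff_locallyP; rewrite de; split=> //.
Unshelve. all: by end_near. Qed.

Lemma Ck_eq V W k (U : set V) (f g : V -> W) :
  open U -> (forall x, U x -> f x = g x) -> Ck k U f -> Ck k U g.
Proof.
move=> oU; elim: k f g => [|k IH] f g fg.
  move=> cf x Ux; rewrite /prop_for /continuous_at -fg//.
  apply: cvg_trans (cf x Ux); apply: near_eq_cvg.
  by apply: filterS (open_nbhs_nbhs (conj oU Ux)) => y; exact: fg.
have nfg x : U x -> \near x, f x = g x.
  by move=> Ux; apply: filterS (open_nbhs_nbhs (conj oU Ux)) => y; exact: fg.
move=> [df Df]; split=> [x Ux|v].
  by apply: eq_differentiable (df x Ux); exact: nfg.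
by apply: IH (Df v) => x Ux; apply: near_eq_derive; exact: nfg.
Qed.

Lemma Ck_sub V W k (U U' : set V) (f : V -> W) :
  U' `<=` U -> Ck k U f -> Ck k U' f.
Proof.
move=> UU'; elim: k f => [|k IH] f /=; first by move=> cf x /UU'; exact: cf.
by move=> [df Df]; split=> [x /UU'|v]; [exact: df|exact: IH].
Qed.

Lemma Ck_local V W k (U : set V) (f : V -> W) :
  (forall x, U x -> exists2 U', U' x & Ck k U' f) -> Ck k U f.
Proof.
elim: k f => [|k IH] f H /=; first by move=> x /H[U' U'x]; apply.
split=> [x /H[U' U'x [df _]]|v]; first exact: df.
by apply: IH => x /H[U' U'x [_ Df]]; exists U' => //; exact: Df.
Qed.

Lemma CkW V W k (U : set V) (f : V -> W) : Ck k.+1 U f -> Ck k U f.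
Proof.
elim: k f => [|k IH] f /=.
  by move=> [df _] x /df; exact: differentiable_continuous.
by move=> [df Df]; split=> // v; apply: IH; exact: Df.
Qed.

Lemma Ck_cst V W k (U : set V) (a : W) : Ck k U (cst a).
Proof.
elim: k a => [|k IH] a /=; first by move=> x _; exact: cst_continuous.
split=> [x _|v]; first exact: differentiable_cst.
by rewrite (_ : 'D_v (cst a) = cst 0)//; apply/funext => x; exact: derive_cst.
Qed.

Lemma CkD V W k (U : set V) (f g : V -> W) :
  open U -> Ck k U f -> Ck k U g -> Ck k U (f + g).
Proof.
move=> oU; elim: k f g => [|k IH] f g /=.
  by move=> cf cg x Ux; apply: continuousD; [exact: cf|exact: cg].
move=> [df Df] [dg Dg]; split=> [x Ux|v].
  by apply: differentiableD; [exact: df|exact: dg].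
apply: Ck_eq (IH _ _ (Df v) (Dg v)) => // x Ux.
by rewrite deriveD//; apply: diff_derivable; [exact: df|exact: dg].
Qed.

Lemma CkM V k (U : set V) (f g : V -> R) :
  open U -> Ck k U f -> Ck k U g -> Ck k U (f * g).
Proof.
move=> oU; elim: k f g => [|k IH] f g.
  by move=> cf cg x Ux; apply: continuousM; [exact: cf|exact: cg].
move=> Cf Cg; have [df Df] := Cf; have [dg Dg] := Cg; split=> [x Ux|v].
  by apply: differentiableM; [exact: df|exact: dg].
apply: Ck_eq (CkD oU (IH _ _ (CkW Cf) (Dg v)) (IH _ _ (CkW Cg) (Df v))) => // x Ux.
by rewrite deriveM//; apply: diff_derivable; [exact: df|exact: dg].
Qed.

Lemma Ck_coord V n k (U : set V) (f : V -> 'rV[R]_n) j :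
  open U -> Ck k U f -> Ck k U (fun x => f x 0 j).
Proof.
move=> oU; elim: k f => [|k IH] f /=.
  move=> cf x Ux.
  exact: (continuous_comp (cf x Ux) (@coord_continuous _ 1 n 0 j (f x))).
move=> [df Df]; split=> [x Ux|v].
  exact: (differentiable_comp (df x Ux) (@differentiable_coord _ 1 n (f x) 0 j)).
apply: Ck_eq (IH _ (Df v)) => // x Ux.
by rewrite derive_mx ?mxE //; apply: diff_derivable; exact: df.
Qed.

Lemma Ck_sum V W k (U : set V) (I : Type) (r : seq I) (F : I -> V -> W) :
  open U -> (forall i, Ck k U (F i)) -> Ck k U (\sum_(i <- r) F i).
Proof.
move=> oU CF; elim/big_ind: _ => //; first exact: Ck_cst.
by move=> f g; exact: CkD.
Qed.

Lemma Ck_comp V n k (U : set V) (U' : set 'rV[R]_n)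
    (f : V -> 'rV[R]_n) (g : 'rV[R]_n -> R) :
  open U -> (forall x, U x -> U' (f x)) ->
  Ck k U f -> Ck k U' g -> Ck k U (g \o f).
Proof.
move=> oU UU'; elim: k g => [|k IH] g.
  move=> cf cg x Ux; apply: continuous_comp; first exact: cf.
  by apply: cg; exact: UU'.
move=> Cf Cg; have [df Df] := Cf; have [dg Dg] := Cg; split=> [x Ux|v].
  by apply: differentiable_comp; [exact: df|apply: dg; exact: UU'].
pose F j := (fun x => ('D_v f x) 0 j) * ('D_('e_j) g \o f).
apply: (@Ck_eq _ _ _ _ (\sum_j F j)) => //; last first.
  apply: Ck_sum => // j; apply: CkM => //; first exact: Ck_coord (Df v).
  by apply: IH (Dg _); exact: CkW.
move=> x Ux; have dfx := df _ Ux; have dgx := dg _ (UU' _ Ux).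
rewrite deriveE; last exact: differentiable_comp.
rewrite diff_comp //= -(deriveE v dfx) fct_sumE.
rewrite [X in _ = 'd g (f x) X]row_sum_delta linear_sum; apply: eq_bigr => j _.
by rewrite linearZ /= -deriveE.
Qed.

Definition smooth_on V W (U : set V) (f : V -> W) : Prop := forall k, Ck k U f.

End Ck.

(* The values of chart_fun outside chart_dom, and of chart_inv outside the image
   of chart_dom, are irrelevant. *)
Record chart (R : realType) (n : nat) (T : topologicalType) := Chart {
  chart_dom : set T;
  chart_fun :> T -> 'rV[R]_n;
  chart_inv : 'rV[R]_n -> T;
  chart_dom_open : open chart_dom;
  chart_im_open : open (chart_fun @` chart_dom);
  chartK : forall p, chart_dom p -> chart_inv (chart_fun p) = p;
  chart_continuous : forall p, chart_dom p -> {for p, continuous chart_fun};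
  chart_inv_continuous : forall x, (chart_fun @` chart_dom) x ->
    {for x, continuous chart_inv}
}.

Arguments chart_im_open {R n T} c.

Definition chart_im (R : realType) n T (c : chart R n T) : set 'rV[R]_n :=
  c @` chart_dom c.

(* The atlas need not be maximal. The manifold may be empty or disconnected. *)
Record manifold (R : realType) (n : nat) := Manifold {
  manifold_sort :> topologicalType;
  atlas : set (chart R n manifold_sort);
  manifold_hausdorff : hausdorff_space manifold_sort;
  manifold_second_countable : @second_countable manifold_sort;
  atlas_cover : forall p, exists2 c, atlas c & chart_dom c p;
  atlas_compatible : forall c d, atlas c -> atlas d ->
    smooth_on (c @` (chart_dom c `&` chart_dom d)) (d \o chart_inv c)
}.

Section SmoothFunctions.
Context {R : realType} {n : nat} (M : manifold R n).

Definition smooth : {pred M -> R} := mem [set f : M -> R |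
  forall c, atlas c -> smooth_on (chart_im c) (f \o chart_inv c)].

(* The algebra of smooth real-valued functions on M. *)
Record Cinfty := SmoothFun {
  Cinfty_fun :> M -> R;
  CinftyP : Cinfty_fun \in smooth
}.

HB.instance Definition _ := [isSub for Cinfty_fun].
HB.instance Definition _ := [Choice of Cinfty by <:].

Lemma smooth_cst (a : R) : cst a \in smooth.
Proof. by rewrite inE => c _ k; exact: Ck_cst. Qed.

Lemma smoothD (f g : M -> R) :
  f \in smooth -> g \in smooth -> f + g \in smooth.
Proof.
rewrite !inE => sf sg c ac k.
have := CkD (chart_im_open c) (sf c ac k) (sg c ac k); exact.
Qed.

Lemma smoothM (f g : M -> R) :
  f \in smooth -> g \in smooth -> f * g \in smooth.
Proof.
rewrite !inE => sf sg c ac k.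
have := CkM (chart_im_open c) (sf c ac k) (sg c ac k); exact.
Qed.

Lemma smoothZ a (f : M -> R) : f \in smooth -> a *: f \in smooth.
Proof. exact: (smoothM (smooth_cst a)). Qed.

Lemma smoothN (f : M -> R) : f \in smooth -> - f \in smooth.
Proof. by move=> sf; rewrite -scaleN1r; exact: smoothZ. Qed.

Lemma smooth_subring_closed : subring_closed smooth.
Proof.
split=> [|f g sf sg|]; [exact: (smooth_cst 1)| |exact: smoothM].
by apply: smoothD => //; exact: smoothN.
Qed.

HB.instance Definition _ :=
  GRing.isSubringClosed.Build _ smooth smooth_subring_closed.
HB.instance Definition _ := 
  GRing.SubChoice_isSubComPzRing.Build _ _ Cinfty smooth_subring_closed.

Lemma smooth_scaler_closed : scaler_closed smooth.
Proof. by move=> a f; exact: smoothZ. Qed.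

HB.instance Definition _ :=
  GRing.isScaleClosed.Build _ _ smooth smooth_scaler_closed.
HB.instance Definition _ := [SubZmodule_isSubLmodule of Cinfty by <:].

End SmoothFunctions.

Arguments smooth {R n} M.

Section TangentSpace.
Context {R : realType} {n : nat} (M : manifold R n) (p : M).

(* The tangent space at p is the space of derivations at p of Cinfty M; since M
   is Hausdorff and second countable, these are the same as the derivations of
   germs of smooth functions at p. *)
Definition derivation_at : {pred Cinfty M -> R} := mem [set v : Cinfty M -> R |
  scalar v /\ forall f g : Cinfty M, v (f * g) = v f * g p + f p * v g].

Record tangent := Tangent {
  tangent_fun :> Cinfty M -> R;
  tangentP : tangent_fun \in derivation_at
}.

HB.instance Definition _ := [isSub for tangent_fun].
HB.instance Definition _ := [Choice of tangent by <:].

Lemma derivation_at_submod_closed : submod_closed derivation_at.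
Proof.
split=> [|a v w]; rewrite !inE.
  split=> [b f g|f g]; first by change (0 = b * 0 + 0 :> R); ring.
  by change (0 = 0 * g p + f p * 0 :> R); ring.
move=> [lv Lv] [lw Lw]; split=> [b f g|f g]; rewrite !fctE.
  by rewrite lv lw; rewrite /GRing.scale /=; ring.
by rewrite Lv Lw /GRing.scale /=; ring.
Qed.

HB.instance Definition _ :=
  GRing.isSubmodClosed.Build _ _ derivation_at derivation_at_submod_closed.
HB.instance Definition _ := [SubChoice_isSubLmodule of tangent by <:].

Lemma tangent_linear (v : tangent) : scalar v.
Proof. by have := tangentP v; rewrite inE => -[]. Qed.

Lemma tangent_Leibniz (v : tangent) (f g : Cinfty M) :
  v (f * g) = v f * g p + f p * v g.
Proof. by have := tangentP v; rewrite inE => -[]. Qed.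

End TangentSpace.

Section VectorFields.
Context {R : realType} {n : nat} (M : manifold R n).

(* Smooth vector fields; they form a module over the ring Cinfty M. *)
Record vector_field := VectorField {
  vf_at :> forall p : M, tangent p;
  vf_smooth : forall f : Cinfty M, (fun p => vf_at p f) \in smooth M
}.

HB.instance Definition _ := gen_eqMixin vector_field.
HB.instance Definition _ := gen_choiceMixin vector_field.

Lemma vector_fieldP (X Y : vector_field) : (forall p, X p = Y p) -> X = Y.
Proof.
case: X Y => [X sX] [Y sY] /= XY.
have {}XY : X = Y by exact: functional_extensionality_dep.
by rewrite XY in sX *; rewrite (Prop_irrelevance sX sY).
Qed.

Definition vf_apply (X : vector_field) (f : Cinfty M) : Cinfty M :=
  SmoothFun (vf_smooth X f).

Lemma vf_zero_smooth (f : Cinfty M) :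
  (fun p => (0 : tangent p) f) \in smooth M.
Proof. exact: smooth_cst. Qed.

Lemma vf_add_smooth (X Y : vector_field) (f : Cinfty M) :
  (fun p => (X p + Y p) f) \in smooth M.
Proof. exact: smoothD (vf_smooth X f) (vf_smooth Y f). Qed.

Lemma vf_opp_smooth (X : vector_field) (f : Cinfty M) :
  (fun p => (- X p) f) \in smooth M.
Proof. exact: smoothN (vf_smooth X f). Qed.

Lemma vf_scale_smooth (a : Cinfty M) (X : vector_field) (f : Cinfty M) :
  (fun p => (a p *: X p) f) \in smooth M.
Proof. exact: smoothM (CinftyP a) (vf_smooth X f). Qed.

Definition vf_zero := VectorField vf_zero_smooth.
Definition vf_add X Y := VectorField (vf_add_smooth X Y).
Definition vf_opp X := VectorField (vf_opp_smooth X).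
Definition vf_scale a X := VectorField (vf_scale_smooth a X).

Let vf_addA : associative vf_add.
Proof. by move=> X Y Z; apply: vector_fieldP => p; exact: addrA. Qed.
Let vf_addC : commutative vf_add.
Proof. by move=> X Y; apply: vector_fieldP => p; exact: addrC. Qed.
Let vf_add0 : left_id vf_zero vf_add.
Proof. by move=> X; apply: vector_fieldP => p; exact: add0r. Qed.
Let vf_addN : left_inverse vf_zero vf_opp vf_add.
Proof. by move=> X; apply: vector_fieldP => p; exact: addNr. Qed.

HB.instance Definition _ :=
  GRing.isZmodule.Build vector_field vf_addA vf_addC vf_add0 vf_addN.

Let vf_scaleA a b X : vf_scale a (vf_scale b X) = vf_scale (a * b) X.
Proof. by apply: vector_fieldP => p; exact: scalerA. Qed.
Let vf_scale1 : left_id 1 vf_scale.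
Proof. by move=> X; apply: vector_fieldP => p; exact: scale1r. Qed.
Let vf_scaleDr : right_distributive vf_scale +%R.
Proof. by move=> a X Y; apply: vector_fieldP => p; exact: scalerDr. Qed.
Let vf_scaleDl X : {morph vf_scale^~ X : a b / a + b}.
Proof. by move=> a b; apply: vector_fieldP => p; exact: scalerDl. Qed.

HB.instance Definition _ := GRing.Zmodule_isLmodule.Build (Cinfty M)
  vector_field vf_scaleA vf_scale1 vf_scaleDr vf_scaleDl.

Lemma vf_apply_linear (X : vector_field) (a : R) (f g : Cinfty M) :
  vf_apply X (a *: f + g) = a *: vf_apply X f + vf_apply X g.
Proof. by apply/val_inj/funext => p; exact: tangent_linear. Qed.

Lemma vf_apply_Leibniz (X : vector_field) (f g : Cinfty M) :
  vf_apply X (f * g) = vf_apply X f * g + f * vf_apply X g.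
Proof. by apply/val_inj/funext => p; exact: tangent_Leibniz. Qed.

Definition bracket_fun (X Y : vector_field) (p : M) (f : Cinfty M) : R :=
  X p (vf_apply Y f) - Y p (vf_apply X f).

Lemma bracket_derivation X Y p : bracket_fun X Y p \in derivation_at p.
Proof.
rewrite inE; split=> [a f g|f g]; rewrite /bracket_fun.
  by rewrite !vf_apply_linear !tangent_linear; ring.
rewrite !vf_apply_Leibniz -[vf_apply Y f * g]scale1r -[vf_apply X f * g]scale1r.
by rewrite !tangent_linear !tangent_Leibniz /=; ring.
Qed.

Lemma bracket_smooth X Y (f : Cinfty M) :
  (fun p => Tangent (bracket_derivation X Y p) f) \in smooth M.
Proof.
exact: smoothD (vf_smooth X (vf_apply Y f))
  (smoothN (vf_smooth Y (vf_apply X f))).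
Qed.

Definition bracket X Y : vector_field := VectorField (bracket_smooth X Y).

End VectorFields.

Section Riemannian.
Context {R : realType} {n : nat} (M : manifold R n).

Record riemannian_metric := RiemannianMetric {
  rmetric_at :> forall p : M, tangent p -> tangent p -> R;
  rmetric_sym : forall p (u v : tangent p), rmetric_at u v = rmetric_at v u;
  rmetric_linear : forall p (u : tangent p), scalar (rmetric_at u);
  rmetric_pos : forall p (u : tangent p), u != 0 -> 0 < rmetric_at u u;
  rmetric_smooth : forall X Y : vector_field M,
    (fun p => rmetric_at (X p) (Y p)) \in smooth M
}.

Definition metric_vf (g : riemannian_metric) (X Y : vector_field M) : Cinfty M :=
  SmoothFun (rmetric_smooth g X Y).

Record one_form := OneForm {
  form_at :> forall p : M, {scalar tangent p};
  form_smooth : forall X : vector_field M, (fun p => form_at p (X p)) \in smooth M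
}.

Definition form_vf (eta : one_form) (X : vector_field M) : Cinfty M :=
  SmoothFun (form_smooth eta X).

(* Smooth (1,1)-tensor fields. *)
Record tensor11 := Tensor11 {
  tensor_at :> forall p : M, {linear tangent p -> tangent p};
  tensor_smooth : forall (X : vector_field M) (f : Cinfty M),
    (fun p => tensor_at p (X p) f) \in smooth M
}.

Definition tensor_vf (phi : tensor11) (X : vector_field M) : vector_field M :=
  VectorField (tensor_smooth phi X).

Record affine_connection := AffineConnection {
  connection :> vector_field M -> vector_field M -> vector_field M;
  connection_linear : forall Y, linear (connection^~ Y);
  connection_add : forall X, {morph connection X : Y Z / Y + Z};
  connection_Leibniz : forall X (f : Cinfty M) Y,
    connection X (f *: Y) = vf_apply X f *: Y + f *: connection X Y
}.

Definition torsion_free (D : affine_connection) : Prop :=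
  forall X Y, D X Y - D Y X = bracket X Y.

Definition metric_compatible (g : riemannian_metric) (D : affine_connection) :
  Prop := forall X Y Z,
    vf_apply X (metric_vf g Y Z) = metric_vf g (D X Y) Z + metric_vf g Y (D X Z).

Definition levi_civita (g : riemannian_metric) (D : affine_connection) : Prop :=
  torsion_free D /\ metric_compatible g D.

(* (D_X phi) Y *)
Definition covariant_derivative (D : affine_connection) (phi : tensor11)
    (X Y : vector_field M) : vector_field M :=
  D X (tensor_vf phi Y) - tensor_vf phi (D X Y).

End Riemannian.

Record sasakian_structure (R : realType) (m : nat)
    (M : manifold R m.*2.+1) := SasakianStructure {
  sas_phi : tensor11 M;
  sas_xi : vector_field M;
  sas_eta : one_form M;
  sas_metric : riemannian_metric M;
  sas_connection : affine_connection M;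
  sas_levi_civita : levi_civita sas_metric sas_connection;
  sas_phi2 : forall X, tensor_vf sas_phi (tensor_vf sas_phi X) =
    - X + form_vf sas_eta X *: sas_xi;
  sas_eta_xi : form_vf sas_eta sas_xi = 1;
  sas_phi_xi : tensor_vf sas_phi sas_xi = 0;
  sas_metric_phi : forall X Y,
    metric_vf sas_metric (tensor_vf sas_phi X) (tensor_vf sas_phi Y) =
    metric_vf sas_metric X Y - form_vf sas_eta X * form_vf sas_eta Y;
  sas_nabla_phi : forall X Y,
    covariant_derivative sas_connection sas_phi X Y =
    metric_vf sas_metric X Y *: sas_xi - form_vf sas_eta Y *: X
}.

Section SmoothMaps.
Context {R : realType} {n n' : nat} (M : manifold R n) (N : manifold R n').

(* Continuity makes the sets on which the local expressions are required to be
   smooth open. *)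
Record smooth_map := SmoothMap {
  map_fun :> M -> N;
  map_continuous : continuous map_fun;
  map_smooth : forall (c : chart R n M) (d : chart R n' N), atlas c -> atlas d ->
    smooth_on (chart_im c `&` (map_fun \o chart_inv c) @^-1` chart_dom d)
      (d \o map_fun \o chart_inv c)
}.

Lemma pullback_smooth (F : smooth_map) (f : Cinfty N) : f \o F \in smooth M.
Proof.
rewrite inE => c ac k; apply: Ck_local => x cx.
have [d ad dx] := atlas_cover (F (chart_inv c x)).
pose U := chart_im c `&` (F \o chart_inv c) @^-1` chart_dom d.
exists U; first by split.
have oU : open U.
  rewrite openE => y [cy dy]; apply: filterI.
    exact: open_nbhs_nbhs (conj (chart_im_open c) cy).
  have cF : {for y, continuous (F \o chart_inv c)}.
    apply: continuous_comp; first exact: chart_inv_continuous.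
    exact: map_continuous.
  by apply: cF; apply: open_nbhs_nbhs; split; first exact: chart_dom_open.
have sf : Ck k (chart_im d) (f \o chart_inv d).
  by have := CinftyP f; rewrite inE; exact.
have dU y : U y -> chart_im d ((d \o F \o chart_inv c) y).
  by move=> [_ dy]; exists (F (chart_inv c y)).
apply: Ck_eq (Ck_comp oU dU (map_smooth F ac ad k) sf) => // y [_ dy] /=.
by rewrite chartK.
Qed.

Definition pullback (F : smooth_map) (f : Cinfty N) : Cinfty M :=
  SmoothFun (pullback_smooth F f).

Lemma differential_derivation (F : smooth_map) (p : M) (v : tangent p) :
  (fun f => v (pullback F f)) \in derivation_at (F p).
Proof.
rewrite inE; split=> [a f g|f g].
  rewrite -tangent_linear; congr (v _); exact/val_inj.
have <- : pullback F f * pullback F g = pullback F (f * g) by exact/val_inj.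
exact: tangent_Leibniz.
Qed.

Definition differential (F : smooth_map) (p : M) (v : tangent p) :
  tangent (F p) := Tangent (differential_derivation F v).

Definition immersion (F : smooth_map) : Prop :=
  forall p, injective (differential F (p := p)).

End SmoothMaps.

Section Submanifolds.
Context {R : realType} {k n : nat} (M : manifold R k) (N : manifold R n).

(* Submanifolds are injectively immersed; M need not carry the subspace topology
   of N. *)
Record submanifold := Submanifold {
  inclusion :> smooth_map M N;
  inclusion_inj : injective inclusion;
  inclusion_immersion : immersion inclusion
}.

Variable i : submanifold.

Definition related_at (U : vector_field M) (X : vector_field N) (p : M) : Prop :=
  differential i (U p) = X (i p).

(* X along M is a smooth section of TM. *)
Definition section_of_tangent (X : vector_field N) : Prop :=
  exists U : vector_field M, forall p, related_at U X p.

Variables (g : riemannian_metric N) (D : affine_connection N).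

Definition normal_vector (p : M) (w : tangent (i p)) : Prop :=
  forall u : tangent p, g (i p) w (differential i u) = 0.

Definition induced_metric (p : M) (u v : tangent p) : R :=
  g (i p) (differential i u) (differential i v).

(* For U, V tangent to M, extended near p to fields X, Y of the ambient manifold,
   sff is the normal part of D_X Y in the Gauss decomposition
     D_X Y = (tangential part) + h(U, V).
   As every tangent vector at p has such an extension, this determines sff. *)
Record second_fundamental_form := SecondFundamentalForm {
  sff :> forall p : M, tangent p -> tangent p -> tangent (i p);
  sff_normal : forall p (u v : tangent p), normal_vector (sff u v);
  sff_gauss : forall (U V : vector_field M) (X Y : vector_field N) (p : M),
    (\forall q \near p, related_at U X q /\ related_at V Y q) ->
    exists t : tangent p, D X Y (i p) = differential i t + sff (U p) (V p)
}.

Definition orthonormal_basis (p : M) (e : 'I_k -> tangent p) : Prop :=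
  (forall a b, induced_metric (e a) (e b) = (a == b)%:R) /\
  (forall u, u = \sum_a induced_metric u (e a) *: e a).

(* The mean curvature vector is (1 / dim M) times the trace of h. *)
Definition mean_curvature_vector (h : second_fundamental_form)
    (H : forall p : M, tangent (i p)) : Prop :=
  forall p (e : 'I_k -> tangent p), orthonormal_basis e ->
    H p = k%:R^-1 *: \sum_a h p (e a) (e a).

Definition totally_umbilical (h : second_fundamental_form) : Prop :=
  exists2 H, mean_curvature_vector h H &
    forall p u v, h p u v = induced_metric u v *: H p.

Definition totally_geodesic (h : second_fundamental_form) : Prop :=
  forall p u v, h p u v = 0.

End Submanifolds.

(* Main.v *)
Require Import Defs.
From mathcomp Require Import all_boot all_order all_algebra.
From mathcomp Require Import all_classical all_reals all_analysis.

(** Evaluate the second fundamental form on the Reeb field. On a Sasakian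
manifold the covariant derivative of [xi] along [X] is [- phi X]
([connection_reeb]), so [xi] is a unit field whose integral curves are
geodesics, as [phi xi = 0] ([reeb_geodesic]). If [xi] is tangent to [M], say
[xi = U] along [M], then the Gauss decomposition of [D_xi xi = 0] exhibits the
normal vector [h(U, U)] as a tangent one, whence [h(U, U) = 0]
([sff_autoparallel]). For a totally umbilical [M] this reads [g(xi, xi) H = 0],
and [xi] has unit length, so [H] vanishes, and with it [h = g H]. *)

Set Implicit Arguments.
Unset Strict Implicit.
Unset Printing Implicit Defensive.

Import Order.TTheory GRing.Theory Num.Theory.

Local Open Scope classical_set_scope.
Local Open Scope ring_scope.

Section MetricOnFields.
Context {R : realType} {n : nat} {M : manifold R n}.
Implicit Types (X Y Z : vector_field M) (f : Cinfty M).

Lemma vf_apply1 X : vf_apply X 1 = 0.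
Proof.
have := vf_apply_Leibniz X 1 1; rewrite !mulr1 mul1r => E.
by apply: (addrI (vf_apply X 1)); rewrite addr0 -E.
Qed.

Lemma tensor_vfB (phi : tensor11 M) X Y :
  tensor_vf phi (X - Y) = tensor_vf phi X - tensor_vf phi Y.
Proof. by apply: vector_fieldP => p; exact: linearB. Qed.

Lemma tensor_vfZ (phi : tensor11 M) f X :
  tensor_vf phi (f *: X) = f *: tensor_vf phi X.
Proof. by apply: vector_fieldP => p; exact: linearZ. Qed.

Lemma connectionr0 (D : affine_connection M) X : D X 0 = 0.
Proof. by apply: (addrI (D X 0)); rewrite -connection_add !addr0. Qed.

Variable g : riemannian_metric M.

Lemma rmetricD (p : M) (u v w : tangent p) : g p u (v + w) = g p u v + g p u w.
Proof. by have := rmetric_linear g u 1 v w; rewrite scale1r /= mul1r. Qed.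

Lemma rmetricr0 (p : M) (u : tangent p) : g p u 0 = 0.
Proof. by apply: (addrI (g p u 0)); rewrite -rmetricD !addr0. Qed.

Lemma rmetric_eq0 (p : M) (u : tangent p) : g p u u = 0 -> u = 0.
Proof.
move=> guu; apply/eqP; case: eqP => // /eqP /(rmetric_pos g).
by rewrite guu ltxx.
Qed.

Lemma metric_vfr0 X : metric_vf g X 0 = 0.
Proof. by apply/val_inj/funext => p; exact: rmetricr0. Qed.

Lemma metric_vfC X Y : metric_vf g X Y = metric_vf g Y X.
Proof. by apply/val_inj/funext => p; exact: rmetric_sym. Qed.

(** Differentiate [g(Y, Y) = 1]: a field of constant length is orthogonal to
its covariant derivatives. *)
Lemma metric_connection_unit (D : affine_connection M) X Y :
  metric_compatible g D -> metric_vf g Y Y = 1 -> metric_vf g (D X Y) Y = 0.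
Proof.
move=> gD Y1; have := gD X Y Y.
rewrite Y1 vf_apply1 [metric_vf g Y _]metric_vfC => E.
apply/val_inj/funext => p; have E2 : 0 = metric_vf g (D X Y) Y p *+ 2.
  exact: (congr1 (fun f : Cinfty M => f p) E).
by apply/eqP; rewrite -[_ == _](mulrn_eq0 _ 2) -E2.
Qed.

End MetricOnFields.

Section Sasakian.
Context {R : realType} {m : nat} {M : manifold R m.*2.+1}.
Variable sas : sasakian_structure M.
Local Notation phi := (tensor_vf (sas_phi sas)).
Local Notation xi := (sas_xi sas).
Local Notation eta := (form_vf (sas_eta sas)).
Local Notation g := (metric_vf (sas_metric sas)).
Local Notation D := (sas_connection sas).

(** The compatibility of [g] with [phi], paired with [phi xi = 0]. *)
Lemma eta_metric X : eta X = g X xi.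
Proof.
have := sas_metric_phi sas X xi.
rewrite sas_phi_xi sas_eta_xi mulr1 metric_vfr0 => E.
by apply/esym/eqP; rewrite -subr_eq0 -E.
Qed.

Lemma reeb_unit : g xi xi = 1.
Proof. by rewrite -eta_metric sas_eta_xi. Qed.

(** The formula for the covariant derivative of [phi], applied to [phi xi = 0],
gives [phi (D_X xi) = X - eta(X) xi]. Applying [phi] again determines
[D_X xi] up to its component along [xi], which vanishes because [xi] has unit
length. *)
Lemma connection_reeb X : D X xi = - phi X.
Proof.
have phiD : phi (D X xi) = X - eta X *: xi.
  have := sas_nabla_phi sas X xi.
  rewrite /covariant_derivative sas_phi_xi connectionr0 sub0r.
  rewrite sas_eta_xi scale1r -eta_metric => E.
  by rewrite -[LHS]opprK E opprB.
have := sas_phi2 sas (D X xi).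
rewrite phiD tensor_vfB tensor_vfZ sas_phi_xi scaler0 subr0 eta_metric.
rewrite (metric_connection_unit X (sas_levi_civita sas).2 reeb_unit).
by rewrite scale0r addr0 => ->; rewrite opprK.
Qed.

Lemma reeb_geodesic : D xi xi = 0.
Proof. by rewrite connection_reeb sas_phi_xi oppr0. Qed.

End Sasakian.

(** By the Gauss decomposition, [h(U, U)] is normal and tangent at once. *)
Lemma sff_autoparallel (R : realType) (k n : nat) (M : manifold R k)
    (N : manifold R n) (i : submanifold M N) (g : riemannian_metric N)
    (D : affine_connection N) (h : second_fundamental_form i g D)
    (U : vector_field M) (X : vector_field N) :
  (forall p, related_at i U X p) -> D X X = 0 ->
  forall p, h p (U p) (U p) = 0.
Proof.
move=> UX DX0 p.
have [|t] := @sff_gauss _ _ _ _ _ _ _ _ h U U X X p.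
  by apply: filterE => q; split; exact: UX.
rewrite DX0 /= => /esym E.
apply: (rmetric_eq0 (g := g)).
have := rmetricr0 g (h p (U p) (U p)).
by rewrite -[X in g _ _ X = _]E rmetricD sff_normal add0r.
Qed.

Theorem proposition8p1 (R : realType) (m k : nat)
  (Mbar : manifold R m.*2.+1) (sas : sasakian_structure Mbar)
  (M : manifold R k) (i : submanifold M Mbar)
  (h : second_fundamental_form i (sas_metric sas) (sas_connection sas)) :
  section_of_tangent i (sas_xi sas) ->
  totally_umbilical h -> totally_geodesic h.
Proof.
move=> [U Uxi] [H _ hH] p u v.
have := sff_autoparallel h Uxi (reeb_geodesic sas) p.
rewrite hH /induced_metric (Uxi p).
have /(congr1 (fun f : Cinfty Mbar => f (i p))) /= -> := reeb_unit sas.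
by rewrite scale1r => H0; rewrite hH H0 scaler0.
Qed.
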